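(* Let $\mathcal V=[m]$ and let $\mathcal G=(\mathcal V,\mathcal E)$ be a graph without loops and multiple edges whose edges carry an arbitrary fixed orientation, so that $\mathcal E$ is a set of ordered pairs with $(i,j)\in\mathcal E\Rightarrow(j,i)\notin\mathcal E$. Let $\theta_i\in\mathbb R^n$ for $i\in\mathcal V$ and $\theta_{ij}\in\mathbb R^{n\times n}$ for $(i,j)\in\mathcal E$, let $\tau>0$, and assume that every smoothed local Wasserstein distance $d_{\theta_{ij},\tau}:\mathcal S\times\mathcal S\to\mathbb R$, $(i,j)\in\mathcal E$, is (finite and) differentiable. Let $$E_\tau:\mathcal W\to\mathbb R,\qquad E_\tau(W)=\sum_{i\in\mathcal V}\Big(\langle\theta_i,W_i\rangle+\sum_{j:(i,j)\in\mathcal E}d_{\theta_{ij},\tau}(W_i,W_j)\Big).$$ Then the Euclidean gradient of $E_\tau$ at $W\in\mathcal W$ is the matrix $\nabla E_\tau(W)\in T^m$ whose $i$-th row, $i\in\mathcal V$, is $$\nabla_iE_\tau(W)=P_T(\theta_i)+\sum_{j:(i,j)\in\mathcal E}\nabla_1d_{\theta_{ij},\tau}(W_i,W_j)+\sum_{j:(j,i)\in\mathcal E}\nabla_2d_{\theta_{ji},\tau}(W_j,W_i),$$ where $\nabla_1d_{\theta_{ij},\tau}(W_i,W_j)\in T$ is the Euclidean gradient of $d_{\theta_{ij},\tau}(\cdot,W_j):\mathcal S\to\mathbb R$ at $W_i$, and $\nabla_2d_{\theta_{ji},\tau}(W_j,W_i)\in T$ is the Euclidean gradient of $d_{\theta_{ji},\tau}(W_j,\cdot):\mathcal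 S\to\mathbb R$ at $W_i$.
   Context: $\mathbf 1_n=(1,\dots,1)^\top\in\mathbb R^n$. $\mathcal S=\{q\in\mathbb R^n: q_i>0\ \forall i,\ \langle\mathbf 1_n,q\rangle=1\}$ has constant tangent space $T=\{v\in\mathbb R^n:\langle\mathbf 1_n,v\rangle=0\}$, with orthogonal projection $P_T(x)=x-\frac1n\langle\mathbf 1_n,x\rangle\mathbf 1_n$. The assignment manifold is $\mathcal W=\{W\in\mathbb R^{m\times n}: W_{ij}>0,\ W\mathbf 1_n=\mathbf 1_m\}$ (product of $m$ copies of $\mathcal S$; $W_i$ denotes the $i$-th row, identified with a vector in $\mathcal S$), with constant tangent space $T^m=\{V\in\mathbb R^{m\times n}:V\mathbf 1_n=0\}$. The Euclidean gradient of a differentiable function $f:\mathcal S\to\mathbb R$ (resp. $f:\mathcal W\to\mathbb R$) at a point is the unique element $\nabla f\in T$ (resp. $T^m$) with $\langle\nabla f,v\rangle=Df[v]$ for all tangent vectors $v\in T$ (resp. $T^m$), with respect to the Euclidean (Frobenius) inner product. For $\Theta\in\mathbb R^{n\times n}$ and $\mu_1,\mu_2\in\mathcal S$, $\Pi(\mu_1,\mu_2)=\{M\in\mathbb R_+^{n\times n}:M\mathbf 1_n=\mu_1,\ M^\top\mathbf 1_n=\mu_2\}$ and $$d_{\Theta,\tau}(\mu_1,\mu_2)=\min_{M\in\Pi(\mu_1,\mu_2)}\{\langle\Theta,M\rangle+F_\tau(M)\},$$ where $F_\tau:\mathbb R^{n\times n}\to\mathbb R\cup\{+\infty\}$ is a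 fixed proper, lower semicontinuous, convex smoothing function and $\langle A,B\rangle=\mathrm{tr}(A^\top B)$. *)

(* Defs.v *)
From HB Require Import structures.
From mathcomp Require Import all_boot all_order all_algebra.
From mathcomp Require Import all_classical all_reals all_analysis.

Set Implicit Arguments.
Unset Strict Implicit.
Unset Printing Implicit Defensive.
Import Order.TTheory GRing.Theory Num.Theory.
Import numFieldNormedType.Exports.

Local Open Scope classical_set_scope.
Local Open Scope ring_scope.

(* Vectors of R^n are row vectors, so that the i-th row of W : 'M_(m, n) is
   [row i W] without a transpose. *)

Definition frob (R : realType) (m n : nat) (A B : 'M[R]_(m, n)) : R :=
  \tr (A^T *m B).

Definition ones (R : realType) (n : nat) : 'rV[R]_n := const_mx 1.
Arguments ones {R n}.

Definition simplex (R : realType) (n : nat) : set 'rV[R]_n :=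
  [set q : 'rV[R]_n | (forall i, 0 < q 0 i) /\ frob ones q = 1].
Arguments simplex {R n}.

Definition tangent (R : realType) (n : nat) : set 'rV[R]_n :=
  [set v : 'rV[R]_n | frob ones v = 0].
Arguments tangent {R n}.

Definition proj_tangent (R : realType) (n : nat) (x : 'rV[R]_n) : 'rV[R]_n :=
  x - (n%:R^-1 * frob ones x) *: ones.

Definition assignment_manifold (R : realType) (m n : nat) :
    set 'M[R]_(m, n) :=
  [set W : 'M[R]_(m, n) | (forall i j, 0 < W i j) /\ W *m ones^T = ones^T].
Arguments assignment_manifold {R m n}.

Definition assignment_tangent (R : realType) (m n : nat) :
    set 'M[R]_(m, n) :=
  [set V : 'M[R]_(m, n) | V *m ones^T = 0].
Arguments assignment_tangent {R m n}.

(* Only the values of f on A matter, so f may be any extension of a function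
   on A. When A is relatively open in the affine space x + T, the values of
   L on T are determined by f. *)
Definition is_differential_on (R : realType) (V : normedModType R)
    (A : set V) (f : V -> R) (x : V) (L : {linear V -> R}) : Prop :=
  continuous L /\
  forall y, f y - f x - L (y - x) =o_(y \near within A (nbhs x)) (y - x).

Definition differentiable_on (R : realType) (V : normedModType R)
    (A : set V) (f : V -> R) : Prop :=
  forall x, A x -> exists L : {linear V -> R}, is_differential_on A f x L.

Definition is_gradient (R : realType) (m n : nat) (A T : set 'M[R]_(m, n))
    (f : 'M[R]_(m, n) -> R) (x g : 'M[R]_(m, n)) : Prop :=
  T g /\ exists2 L : {linear 'M[R]_(m, n) -> R},
    is_differential_on A f x L & forall v, T v -> frob g v = L v.

(* The default 0 is used only if f is not differentiable at x. *)
Definition gradient (R : realType) (m n : nat) (A T : set 'M[R]_(m, n))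
    (f : 'M[R]_(m, n) -> R) (x : 'M[R]_(m, n)) : 'M[R]_(m, n) :=
  xget 0 [set g | is_gradient A T f x g].

Definition couplings (R : realType) (n : nat) (mu1 mu2 : 'rV[R]_n) :
    set 'M[R]_n :=
  [set M : 'M[R]_n | [/\ forall i j, 0 <= M i j,
               M *m ones^T = mu1^T & M^T *m ones^T = mu2^T]].

Definition eproper (R : realType) (T : Type) (F : T -> \bar R) : Prop :=
  (forall x, F x != -oo%E) /\ exists x, F x != +oo%E.

Definition econvex (R : realType) (V : lmodType R) (F : V -> \bar R) : Prop :=
  forall (x y : V) (t : R), 0 <= t <= 1 ->
    (F (t *: x + (1 - t) *: y)%R <= t%:E * F x + (1 - t)%:E * F y)%E.

Definition smoothing_function (R : realType) (n : nat)
    (F : 'M[R]_n -> \bar R) : Prop :=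
  [/\ eproper F, lower_semicontinuous F & econvex F].

(* The set below contains the minimum as its only element. For a smoothing
   function F and mu1, mu2 in the simplex the minimum exists, by compactness,
   so the default +oo is never used. *)
Definition wasserstein (R : realType) (n : nat) (F : 'M[R]_n -> \bar R)
    (Theta : 'M[R]_n) (mu1 mu2 : 'rV[R]_n) : \bar R :=
  let costs :=
    [set ((frob Theta M)%:E + F M)%E | M in couplings mu1 mu2] in
  xget +oo%E (costs `&` lbound costs).

Definition rwasserstein (R : realType) (n : nat) (F : 'M[R]_n -> \bar R)
    (Theta : 'M[R]_n) (mu1 mu2 : 'rV[R]_n) : R :=
  fine (wasserstein F Theta mu1 mu2).

Definition assignment_energy (R : realType) (m n : nat)
    (E : {set 'I_m * 'I_m}) (theta : 'I_m -> 'rV[R]_n)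
    (Theta : 'I_m -> 'I_m -> 'M[R]_n) (F : 'M[R]_n -> \bar R)
    (W : 'M[R]_(m, n)) : R :=
  \sum_(i < m) (frob (theta i) (row i W) +
    \sum_(j < m | (i, j) \in E)
      rwasserstein F (Theta i j) (row i W) (row j W)).

(* Main.v *)
(** The differential of a local distance at (W_i, W_j) is a linear form L on
pairs, and L (v, w) = L (v, 0) + L (0, w) splits it into the partial
differentials, which the two partial gradients represent on T. Summing over
the edges, the energy has a first order expansion with linear part a sum of
terms <g, V_i>; collecting, for each i, the edges leaving i and the edges
entering i (an exchange of the summations over i and j) writes this linear
part as <G, V>, with the rows of G as claimed. *)

From HB Require Import structures.
Require Import Defs.
From mathcomp Require Import all_boot all_order all_algebra.
From mathcomp Require Import all_classical all_reals all_analysis.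
From mathcomp Require Import ring.
Import Order.TTheory GRing.Theory Num.Theory.
Import numFieldNormedType.Exports.
Local Open Scope classical_set_scope.
Local Open Scope ring_scope.

(** * The Frobenius inner product *)

Lemma frobE {R : realType} {m n : nat} (A B : 'M[R]_(m, n)) :
  frob A B = \sum_i \sum_j A i j * B i j.
Proof.
rewrite /frob /mxtrace exchange_big; apply: eq_bigr => j _.
by rewrite mxE; apply: eq_bigr => i _; rewrite mxE.
Qed.

Lemma frob_rowE {R : realType} {n : nat} (u v : 'rV[R]_n) :
  frob u v = \sum_j u 0 j * v 0 j.
Proof. by rewrite frobE big_ord1. Qed.

Lemma frob_sum_row {R : realType} {m n : nat} (A B : 'M[R]_(m, n)) :
  frob A B = \sum_i frob (row i A) (row i B).
Proof.
rewrite frobE; apply: eq_bigr => i _; rewrite frob_rowE.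
by apply: eq_bigr => j _; rewrite !mxE.
Qed.

Lemma frobC {R : realType} {m n : nat} (A B : 'M[R]_(m, n)) :
  frob A B = frob B A.
Proof.
by rewrite /frob -mxtrace_tr trmx_mul trmxK.
Qed.

Lemma frob_is_linear {R : realType} {m n : nat} (A : 'M[R]_(m, n)) :
  linear (frob A).
Proof. by move=> a B C; rewrite /frob mulmxDr -scalemxAr linearP. Qed.

HB.instance Definition _ {R : realType} {m n : nat} (A : 'M[R]_(m, n)) :=
  GRing.isLinear.Build R 'M[R]_(m, n) R _ (frob A) (frob_is_linear A).

Lemma frobDl {R : realType} {m n : nat} (A B C : 'M[R]_(m, n)) :
  frob (A + B) C = frob A C + frob B C.
Proof. by rewrite !(frobC _ C) linearD. Qed.

Lemma frob_suml {R : realType} {m n : nat} (I : Type) (r : seq I) (P : pred I)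
    (A : I -> 'M[R]_(m, n)) (B : 'M[R]_(m, n)) :
  frob (\sum_(i <- r | P i) A i) B = \sum_(i <- r | P i) frob (A i) B.
Proof. by rewrite frobC linear_sum; apply: eq_bigr => i _; rewrite frobC. Qed.

Lemma frob_continuous {R : realType} {m n : nat} (A : 'M[R]_(m, n)) :
  continuous (frob A).
Proof.
(* As a sum of functions over index pairs, continuity follows by induction on the sum. *)
rewrite (_ : frob A =
    \sum_ij (fun B : 'M[R]_(m, n) => A ij.1 ij.2 * B ij.1 ij.2)).
  elim/big_ind : _ => [B|f g cf cg B|ij _ B].
  - exact: (@cst_continuous _ _ (0 : R)).
  - exact: continuousD (cf B) (cg B).
  - by apply: continuousM; [exact: cst_continuous|exact: coord_continuous].
by apply/funext => B; rewrite fct_sumE frobE pair_big.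
Qed.

(** A linear form is determined by its values on the basis [delta_mx 0 j], which become the entries
    of u. This turns partial differentials into vectors. *)
Lemma linear_frob {R : realType} {n : nat} (f : 'rV[R]_n -> R) :
  linear f -> exists u, f = frob u.
Proof.
move=> lf; pose L : {linear 'rV[R]_n -> R} :=
  HB.pack f (GRing.isLinear.Build R 'rV[R]_n R _ f lf).
exists (\row_j L (delta_mx 0 j)); apply/funext => v.
rewrite -[f]/(L : _ -> _) {1}(row_sum_delta v) linear_sum frob_rowE.
by apply: eq_bigr => j _; rewrite linearZ mxE mulrC.
Qed.

(** Matrices carry the max norm, so taking a row is nonexpansive, as [first_order_on_comp] asks of
    its inner map. *)
Lemma norm_row {R : realType} {m n : nat} (A : 'M[R]_(m, n)) (i : 'I_m) :
  `|row i A| <= `|A|.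
Proof.
rewrite [`|row i A|]mx_normrE; apply: bigmax_le => // -[k j] _ /=.
by rewrite mxE [`|A|]mx_normrE; apply: (le_bigmax _ _ (i, j)).
Qed.

(** * Simplex, assignment manifold and their tangent spaces *)

Lemma frob_ones {R : realType} {n : nat} (v : 'rV[R]_n) :
  frob ones v = \sum_j v 0 j.
Proof. by rewrite frob_rowE; apply: eq_bigr => j _; rewrite mxE mul1r. Qed.

Lemma assignment_manifoldE {R : realType} {m n : nat} (W : 'M[R]_(m, n)) :
  assignment_manifold W <-> forall i, simplex (row i W).
Proof.
split=> [[W0 W1] i|WS].
  split=> [j|]; first by rewrite mxE.
  move/matrixP/(_ i 0) : W1; rewrite !mxE => <-; rewrite frob_ones.
  by apply: eq_bigr => j _; rewrite !mxE mulr1.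
split=> [i j|]; first by have [/(_ j)] := WS i; rewrite mxE.
apply/matrixP => i k; rewrite !mxE; have [_ <-] := WS i; rewrite frob_ones.
by apply: eq_bigr => j _; rewrite !mxE mulr1.
Qed.

Lemma assignment_tangentE {R : realType} {m n : nat} (V : 'M[R]_(m, n)) :
  assignment_tangent V <-> forall i, tangent (row i V).
Proof.
split=> [V0 i|VT].
  move/matrixP/(_ i 0) : V0; rewrite !mxE /tangent/= => <-; rewrite frob_ones.
  by apply: eq_bigr => j _; rewrite !mxE mulr1.
apply/matrixP => i k; rewrite !mxE -[RHS](VT i) frob_ones.
by apply: eq_bigr => j _; rewrite !mxE mulr1.
Qed.

Lemma tangentD {R : realType} {n : nat} (u v : 'rV[R]_n) :
  tangent u -> tangent v -> tangent (u + v).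
Proof. by move=> u0 v0; rewrite /tangent/= linearD/= u0 v0 addr0. Qed.

Lemma tangent_sum {R : realType} {n : nat} (I : Type) (r : seq I) (P : pred I)
    (h : I -> 'rV[R]_n) :
  (forall i, P i -> tangent (h i)) -> tangent (\sum_(i <- r | P i) h i).
Proof. by move=> hT; rewrite /tangent/= linear_sum big1. Qed.

Lemma simplex_sub_tangent {R : realType} {n : nat} (p q : 'rV[R]_n) :
  simplex p -> simplex q -> tangent (p - q).
Proof. by move=> [_ p1] [_ q1]; rewrite /tangent/= linearB/= p1 q1 subrr. Qed.

Lemma simplex_dim_gt0 {R : realType} {n : nat} (q : 'rV[R]_n) :
  simplex q -> (0 < n)%N.
Proof.
case: n q => // q [_]; rewrite frob_ones big_ord0 => /esym/eqP.
by rewrite oner_eq0.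
Qed.

(** The correction made by [proj_tangent] is a multiple of [ones], which is orthogonal to v. *)
Lemma frob_proj_tangent {R : realType} {n : nat} (u v : 'rV[R]_n) :
  tangent v -> frob (proj_tangent u) v = frob u v.
Proof.
move=> v0; rewrite frobC linearB linearZ/= [frob v ones]frobC v0.
by rewrite scaler0 subr0 frobC.
Qed.

Lemma proj_tangentP {R : realType} {n : nat} (u : 'rV[R]_n) :
  (0 < n)%N -> tangent (proj_tangent u).
Proof.
move=> n0; rewrite /tangent/= linearB linearZ/=.
have -> : frob (@ones R n) ones = n%:R.
  rewrite frob_ones; under eq_bigr do rewrite mxE.
  by rewrite sumr_const card_ord.
by rewrite /= [_ *: _]mulrC mulrA mulfV ?mul1r ?subrr// pnatr_eq0 -lt0n.
Qed.

(* Every tangent direction is feasible at a point of the simplex, which makes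
   the differential of a function on the simplex unique on the tangent space. *)
Lemma simplex_segment {R : realType} {n : nat} (q v : 'rV[R]_n) :
  simplex q -> tangent v ->
  exists2 d : R, 0 < d & forall t, 0 < t < d -> simplex (q + t *: v).
Proof.
move=> [q0 q1] v0.
have : \forall t \near (0 : R), forall j, 0 < q 0 j + t * v 0 j.
  apply: (filter_forall (nbhs_filter (0 : R))) => j.
  have c : (fun t : R => q 0 j + t * v 0 j) @ (0 : R) --> q 0 j + 0 * v 0 j.
    apply: cvgD; first exact: cvg_cst.
    by apply: cvgM; [exact: cvg_id|exact: cvg_cst].
  by apply: (cvgr_gt _ c); rewrite mul0r addr0.
move=> /nbhs_norm0P[d d0 dP]; exists d => // t /andP[t0 td].
split=> [j|]; first by rewrite !mxE; apply: dP; rewrite /= gtr0_norm.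
by rewrite linearD linearZ/= q1 v0 scaler0 addr0.
Qed.

(** * First-order expansions relative to a set *)

(** The little-o condition in epsilon-delta form. Here phi is a bare function, so expansions can be
    composed and added without bundling a linear map each time. *)
Definition first_order_on {R : realType} {V : normedModType R} (A : set V)
    (f phi : V -> R) (x : V) : Prop :=
  forall e, 0 < e -> exists2 d, 0 < d & forall y, A y -> `|y - x| < d ->
    `|f y - f x - phi (y - x)| <= e * `|y - x|.

Lemma is_differential_on_first_order {R : realType} {V : normedModType R}
    (A : set V) (f : V -> R) (x : V) (L : {linear V -> R}) :
  is_differential_on A f x L <-> continuous L /\ first_order_on A f L x.
Proof.
split=> -[cL fL]; split=> //.
  move=> e e0; have := (iffLR (eqoP _ _ _) (funext fL)) e e0.
  rewrite near_withinE; move=> /nbhs_normP[d d0 dP]; exists d => // y Ay yd.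
  by apply: dP => //=; rewrite distrC.
refine (iffLR (funeqP (fun y => f y - f x - L (y - x)) _) _).
apply/eqoP => e e0; have [d d0 dP] := fL e e0.
rewrite near_withinE; apply/nbhs_normP; exists d => // y /= yd Ay.
by apply: dP => //; rewrite distrC.
Qed.

(** Since h is nonexpansive, the same radius and error bound serve for the composite. The condition
    on psi concerns only increments from x to points of A, so it may be checked on tangent
    vectors. *)
Lemma first_order_on_comp {R : realType} {V U : normedModType R} (A : set V)
    (B : set U) (h : V -> U) (f : U -> R) (phi : U -> R) (psi : V -> R)
    (x : V) :
  (forall y, A y -> B (h y)) ->
  (forall y, `|h y - h x| <= `|y - x|) ->
  (forall y, A y -> psi (y - x) = phi (h y - h x)) ->
  first_order_on B f phi (h x) -> first_order_on A (f \o h) psi x.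
Proof.
move=> hAB hle psiE fphi e e0; have [d d0 dP] := fphi e e0.
exists d => // y Ay yd; rewrite psiE//=.
by rewrite (le_trans (dP _ (hAB _ Ay) (le_lt_trans (hle y) yd)))// ler_pM2l.
Qed.

Lemma first_order_on_linear {R : realType} {V : normedModType R} (A : set V)
    (L : {linear V -> R}) (x : V) : first_order_on A L L x.
Proof.
move=> e e0; exists 1 => // y _ _.
by rewrite linearB subrr normr0 mulr_ge0// ltW.
Qed.

Lemma first_order_onD {R : realType} {V : normedModType R} (A : set V)
    (f g phi psi : V -> R) (x : V) :
  first_order_on A f phi x -> first_order_on A g psi x ->
  first_order_on A (f \+ g) (phi \+ psi) x.
Proof.
move=> fphi gpsi e e0; have e20 : 0 < e / 2 by rewrite divr_gt0.
have [d1 d10 d1P] := fphi _ e20; have [d2 d20 d2P] := gpsi _ e20.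
exists (Num.min d1 d2); first by rewrite lt_min d10.
move=> y Ay; rewrite lt_min => /andP[yd1 yd2].
rewrite [e]splitr mulrDl (_ : _ - _ - _ = (f y - f x - phi (y - x)) +
  (g y - g x - psi (y - x))); last by rewrite /=; ring.
by rewrite (le_trans (ler_normD _ _))// lerD ?d1P ?d2P.
Qed.

Lemma first_order_on_sum {R : realType} {V : normedModType R} (A : set V)
    (I : Type) (r : seq I) (P : pred I) (f phi : I -> V -> R) (x : V) :
  (forall i, P i -> first_order_on A (f i) (phi i) x) ->
  first_order_on A (fun y => \sum_(i <- r | P i) f i y)
    (fun y => \sum_(i <- r | P i) phi i y) x.
Proof.
move=> fphi.
(* Pointwise sums become sums of functions, to which induction on both sums at once applies. *)
have sumE (h : I -> V -> R) :
    (fun y => \sum_(i <- r | P i) h i y) = \sum_(i <- r | P i) h i.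
  by apply/funext => y; rewrite fct_sumE.
rewrite !sumE; apply: (big_ind2 (fun g psi => first_order_on A g psi x)) => //.
  by move=> e e0; exists 1 => // y _ _; rewrite !subr0 normr0 mulr_ge0// ltW.
by move=> *; exact: first_order_onD.
Qed.

(** Along x + t v inside A, both K and L approximate the same increment of f, so t |K v - L v| is at
    most an arbitrarily small multiple of t, and t cancels. *)
Lemma first_order_on_unique {R : realType} {V : normedModType R} (A : set V)
    (f : V -> R) (K L : {linear V -> R}) (x v : V) :
  (exists2 d : R, 0 < d & forall t, 0 < t < d -> A (x + t *: v)) ->
  first_order_on A f K x -> first_order_on A f L x -> K v = L v.
Proof.
move=> [d d0 dA] fK fL; apply/eqP; rewrite -subr_eq0 -normr_le0.
apply/ler_addgt0Pr => e e0; rewrite add0r.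
(* Taking 1 + |v| instead of |v| keeps the divisor positive when v = 0; e' is chosen so that 2 e' (1
   + |v|) = e. *)
have c0 : 0 < 1 + `|v| by rewrite ltr_wpDr.
pose e' := e / 2 / (1 + `|v|); have e'0 : 0 < e' by rewrite !divr_gt0.
have [d1 d10 d1P] := fK _ e'0; have [d2 d20 d2P] := fL _ e'0.
(* For 0 < t < D, the point x + t v lies in A and within both radii d1 and d2 of x. *)
pose D := Num.min d (Num.min (d1 / (1 + `|v|)) (d2 / (1 + `|v|))).
have D0 : 0 < D by rewrite !lt_min d0 !divr_gt0.
have t0 : 0 < D / 2 by rewrite divr_gt0.
have : D / 2 < D by rewrite ltr_pdivrMr// ltr_pMr// ltr1n.
move: (D / 2) t0 => t t0; rewrite !lt_min => /and3P[td].
rewrite !ltr_pdivlMr// => td1 td2.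
have At : A (x + t *: v) by apply: dA; rewrite t0.
have ve : `|t *: v| <= t * (1 + `|v|).
  by rewrite normrZ gtr0_norm// ler_pM2l// lerDr.
have := d1P _ At; have := d2P _ At; rewrite [x + _]addrC addrK => H2 H1.
have {}H1 := H1 (le_lt_trans ve td1); have {}H2 := H2 (le_lt_trans ve td2).
rewrite -(ler_pM2l t0) -[X in X * _](gtr0_norm t0) -normrM mulrBr.
have -> : t * K v - t * L v = (f (t *: v + x) - f x - L (t *: v))
   - (f (t *: v + x) - f x - K (t *: v)).
  have lin (M : {linear V -> R}) : M (t *: v) = t * M v by exact: linearZ.
  rewrite !lin; ring.
rewrite (le_trans (ler_normB _ _))// (le_trans (lerD H2 H1))//.
rewrite -mulrDl (_ : t * e = (e' + e') * (t * (1 + `|v|))).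
  by rewrite ler_pM2l// addr_gt0.
by rewrite -mulrDl -splitr mulrCA mulrA -mulrA divfK ?gt_eqF// mulrC.
Qed.

(** * Gradients from first-order expansions *)

Lemma is_gradient_first_order {R : realType} {m n : nat}
    (A T : set 'M[R]_(m, n)) (f : 'M[R]_(m, n) -> R) (x g : 'M[R]_(m, n)) :
  T g -> first_order_on A f (frob g) x -> is_gradient A T f x g.
Proof.
move=> Tg fg; split=> //; exists (frob g) => //.
by apply/is_differential_on_first_order; split=> //; exact: frob_continuous.
Qed.

(** The vector u may have a component along [ones], but its projection is a gradient, so the default
    of [xget] is not taken. Whichever gradient is chosen agrees with u on tangent vectors, by
    uniqueness of the differential along feasible segments. *)
Lemma gradient_simplexP {R : realType} {n : nat} (f : 'rV[R]_n -> R)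
    (x u : 'rV[R]_n) :
  simplex x -> first_order_on simplex f (frob u) x ->
  tangent (gradient simplex tangent f x) /\
  forall v, tangent v -> frob (gradient simplex tangent f x) v = frob u v.
Proof.
move=> xS fu; have n0 := simplex_dim_gt0 _ xS.
have [] : is_gradient simplex tangent f x (gradient simplex tangent f x).
  apply: (@xgetPex _ 0 [set g | is_gradient simplex tangent f x g]).
  exists (proj_tangent u); apply: is_gradient_first_order.
    exact: proj_tangentP.
  (* Increments between points of the simplex are tangent, and there u and its projection act
     alike. *)
  move=> e /fu[d d0 dP]; exists d => // y yS yx.
  by rewrite frob_proj_tangent ?dP//; exact: simplex_sub_tangent.
move=> gT [L /is_differential_on_first_order[_ fL] gL]; split=> // v vT.
rewrite gL//; apply: (first_order_on_unique _ _ _ _ _ _ _ fL fu).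
exact: simplex_segment.
Qed.

(** * The local distance on one edge *)

(** The gradients g1 and g2 may differ off T from the vectors u1 and u2 representing the joint
    differential. Row increments within the manifold are tangent, so g1 and g2 can replace u1 and u2
    in its expansion. *)
Lemma first_order_on_edge {R : realType} {m n : nat}
    (d : 'rV[R]_n -> 'rV[R]_n -> R) (W : 'M[R]_(m, n)) (i j : 'I_m)
    (g1 := gradient simplex tangent (d^~ (row j W)) (row i W))
    (g2 := gradient simplex tangent (d (row i W)) (row j W)) :
  differentiable_on (simplex `*` simplex) (fun mu => d mu.1 mu.2) ->
  assignment_manifold W ->
  [/\ tangent g1, tangent g2 &
    first_order_on assignment_manifold (fun V => d (row i V) (row j V))
      (fun V => frob g1 (row i V) + frob g2 (row j V)) W].
Proof.
move=> dd /assignment_manifoldE WS.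
have [L /is_differential_on_first_order[_ dL]] :=
  dd (row i W, row j W) (conj (WS i) (WS j)).
have [u1 u1E] : exists u, (fun v => L (v, 0)) = frob u.
  apply: linear_frob => a v w.
  by rewrite -linearP; congr (L (_, _)); rewrite /= scaler0 addr0.
have [u2 u2E] : exists u, (fun v => L (0, v)) = frob u.
  apply: linear_frob => a v w.
  by rewrite -linearP; congr (L (_, _)); rewrite /= scaler0 addr0.
have LE v w : L (v, w) = frob u1 v + frob u2 w.
  by rewrite -u1E -u2E -linearD; congr (L (_, _)); rewrite /= ?addr0 ?add0r.
(* The product carries the max norm, so the slice inclusions and the map from V to its rows i and j
   are nonexpansive. *)
have pair_norm (p : 'rV[R]_n * 'rV[R]_n) c :
    `|p.1| <= c -> `|p.2| <= c -> `|p| <= c.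
  by move=> p1 p2; rewrite prod_normE ge_max p1.
(* Freezing the second argument makes the second component of every increment vanish, which leaves
   only u1. *)
have [T1 E1] : tangent g1 /\ forall v, tangent v -> frob g1 v = frob u1 v.
  apply: gradient_simplexP => //.
  apply: (first_order_on_comp _ _ (fun v => (v, row j W))
    _ _ _ _ _ _ _ dL) => //.
  - by move=> v vS; split=> /=.
  - by move=> v; apply: pair_norm => /=; rewrite ?subrr ?normr0.
  - by move=> v _; rewrite LE /= subrr linear0 addr0.
have [T2 E2] : tangent g2 /\ forall v, tangent v -> frob g2 v = frob u2 v.
  apply: gradient_simplexP => //.
  apply: (first_order_on_comp _ _ (fun v => (row i W, v))
    _ _ _ _ _ _ _ dL) => //.
  - by move=> v vS; split=> /=.
  - by move=> v; apply: pair_norm => /=; rewrite ?subrr ?normr0.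
  - by move=> v _; rewrite LE /= subrr linear0 add0r.
split=> //.
apply: (first_order_on_comp _ _ (fun V => (row i V, row j V)) _ _ _ _ _ _ _ dL).
- by move=> V /assignment_manifoldE VS; split; exact: VS.
- by move=> V; apply: pair_norm => /=;
    rewrite -[X in `|X|]linearB; exact: norm_row.
- move=> V /assignment_manifoldE VS.
  rewrite LE [row i _]linearB [row j _]linearB /=.
  by congr (_ + _); [apply: E1|apply: E2]; exact: simplex_sub_tangent.
Qed.

Theorem proposition4p2 (R : realType) (m n : nat)
    (E : {set 'I_m * 'I_m})
    (theta : 'I_m -> 'rV[R]_n) (Theta : 'I_m -> 'I_m -> 'M[R]_n)
    (tau : R) (F : R -> 'M[R]_n -> \bar R)
    (E_loopless : forall i : 'I_m, (i, i) \notin E)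
    (E_oriented : forall i j : 'I_m, (i, j) \in E -> (j, i) \notin E)
    (tau_gt0 : 0 < tau)
    (F_smoothing : smoothing_function (F tau))
    (d_finite : forall i j : 'I_m, (i, j) \in E ->
       forall mu1 mu2 : 'rV[R]_n, simplex mu1 -> simplex mu2 ->
       wasserstein (F tau) (Theta i j) mu1 mu2 \is a fin_num)
    (d_differentiable : forall i j : 'I_m, (i, j) \in E ->
       differentiable_on (simplex `*` simplex)
         (fun mu : 'rV[R]_n * 'rV[R]_n =>
            rwasserstein (F tau) (Theta i j) mu.1 mu.2))
    (W : 'M[R]_(m, n)) (hW : assignment_manifold W) :
  is_gradient assignment_manifold assignment_tangent
    (assignment_energy E theta Theta (F tau)) W
    (\matrix_(i < m)
      (proj_tangent (theta i)
       + \sum_(j < m | (i, j) \in E)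
           gradient simplex tangent
             (fun mu : 'rV[R]_n =>
                rwasserstein (F tau) (Theta i j) mu (row j W)) (row i W)
       + \sum_(j < m | (j, i) \in E)
           gradient simplex tangent
             (fun mu : 'rV[R]_n =>
                rwasserstein (F tau) (Theta j i) (row j W) mu) (row i W))).
Proof.
have WS := (iffLR (assignment_manifoldE _) hW).
pose g1 i j := gradient simplex tangent
  (fun mu => rwasserstein (F tau) (Theta i j) mu (row j W)) (row i W).
pose g2 i j := gradient simplex tangent
  (fun mu => rwasserstein (F tau) (Theta i j) (row i W) mu) (row j W).
have edge i j (ijE : (i, j) \in E) := first_order_on_edge
  (rwasserstein (F tau) (Theta i j)) W i j (d_differentiable i j ijE) hW.
set G := \matrix_i _.
(* The vector [g2 i j] is attached to the head j of the edge (i, j), so row i collects the entering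
   edges as [g2 j i]. *)
have rowG i : row i G = proj_tangent (theta i) +
    \sum_(j < m | (i, j) \in E) g1 i j + \sum_(j < m | (j, i) \in E) g2 j i.
  by rewrite rowK.
apply: is_gradient_first_order.
  apply/assignment_tangentE => i; rewrite rowG.
  apply: tangentD; first apply: tangentD.
  - exact: (proj_tangentP _ (simplex_dim_gt0 _ (WS i))).
  - by apply: tangent_sum => j /edge[].
  - by apply: tangent_sum => j /edge[].
(* The expansion is first grouped by the tail of each edge, as in the definition of the energy. *)
have fE : first_order_on assignment_manifold
    (assignment_energy E theta Theta (F tau))
    (fun V => \sum_(i < m) (frob (theta i) (row i V) +
       \sum_(j < m | (i, j) \in E)
         (frob (g1 i j) (row i V) + frob (g2 i j) (row j V)))) W.
  apply: first_order_on_sum => i _; apply: first_order_onD.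
    exact: (first_order_on_linear _ (frob (theta i) \o row i)).
  by apply: first_order_on_sum => j /edge[].
(* The linear part has to equal [frob G] only on increments V - W within the manifold; their rows
   are tangent, which allows the projection of [theta i] to be dropped. *)
move=> e /fE[d d0 dP]; exists d => // V VM VW.
suff -> : frob G (V - W) = \sum_(i < m) (frob (theta i) (row i (V - W)) +
    \sum_(j < m | (i, j) \in E)
      (frob (g1 i j) (row i (V - W)) + frob (g2 i j) (row j (V - W)))).
  exact: dP.
have VWT i : tangent (row i (V - W)).
  rewrite linearB; apply: simplex_sub_tangent; last exact: WS.
  exact: (iffLR (assignment_manifoldE _) VM).
rewrite frob_sum_row; under eq_bigr do rewrite rowG 2!frobDl !frob_suml.
under [RHS]eq_bigr do rewrite big_split addrA.
rewrite !big_split/=; congr (_ + _ + _).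
  by apply: eq_bigr => i _; rewrite frob_proj_tangent.
(* Swapping the roles of tail and head turns the sum over entering edges into the sum over leaving
   edges. *)
by rewrite (exchange_big_dep xpredT).
Qed.
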